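(* Let $\mathcal K$ be a weighted simplicial complex restricted to its 2-skeleton, and let $\mathcal L=\mathcal V_0(\mathcal K)\cup\mathcal V_1(\mathcal K)\cup\mathbb T$ with $\mathbb T\subset\mathcal V_2(\mathcal K)$ be a weakly collapsible subcomplex of $\mathcal K$ defined by the subsampling matrix $\Pi$, whose triangles keep their weights from $\mathcal K$, and such that $\operatorname{im}B_2^\top\cap\ker\Pi=\{0\}$ (equivalently $\ker(B_2\Pi B_2^\top)=\ker(B_2B_2^\top)$). Let $\Sigma$ be a collapsing sequence of edges for $\mathcal L$ removing all its triangles, with corresponding sequence $\mathbb T$ of collapsed triangles, and let $C=P_\Sigma B_2\Pi P_{\mathbb T}$ be the corresponding Cholesky multiplier of $P_\Sigma L_1^{\uparrow}(\mathcal L)P_\Sigma^\top$. Then the conditioning of the symmetrically preconditioned $L_1^{\uparrow}=L_1^{\uparrow}(\mathcal K)$ is given by $$\kappa_+\!\left(C^+P_\Sigma L_1^{\uparrow}P_\Sigma^\top (C^+)^\top\right)=\Big(\kappa_+\big((S_1V_1^\top\Pi)^+S_1\big)\Big)^2=\big(\kappa_+(\Pi V_1)\big)^2,$$ where $B_2=U_1S_1V_1^\top$ is the reduced singular value decomposition of $B_2$ ($S_1$ diagonal invertible, $U_1,V_1$ with orthonormal columns), so that the columns of $V_1$ form an orthonormal basis of $\operatorname{im}B_2^\top$.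
   Context: A simplicial complex is a collection of vertex sets (simplices) on a finite vertex set closed under taking nonempty subsets; $\mathcal V_0(\mathcal K),\mathcal V_1(\mathcal K),\mathcal V_2(\mathcal K)$ are its vertices, edges and triangles, and $m_k=|\mathcal V_k(\mathcal K)|$. With a fixed ordering and orientation, $B_2^{\circ}\in\mathbb R^{m_1\times m_2}$ is the unweighted boundary matrix, whose column for a triangle has entries $\pm1$ at its three edges according to $\partial_2[v_1,v_2,v_3]=[v_2,v_3]-[v_1,v_3]+[v_1,v_2]$. Given weights $w_1,w_2\ge0$ on edges and triangles and diagonal matrices $(W_k)_{ii}=\sqrt{w_k(\sigma_i)}$ with $W_1$ invertible, $B_2=W_1^{-1}B_2^{\circ}W_2$ is the weighted boundary matrix and $L_1^{\uparrow}(\mathcal K)=B_2B_2^\top$ the up-Laplacian. The subsampling matrix $\Pi\in\mathbb R^{m_2\times m_2}$ of $\mathbb T$ is diagonal with $\Pi_{ii}=1$ if the $i$-th triangle is in $\mathbb T$, and $0$ otherwise; thus $L_1^{\uparrow}(\mathcal L)=B_2\Pi B_2^\top$. An edge $\sigma$ is free in a complex if it is contained in exactly one triangle $\tau(\sigma)$; the collapse at $\sigma$ removes $\sigma$ and $\tau(\sigma)$. A sequence of edges $\sigma_1,\sigma_2,\dots$ is a collapsing sequence if $\sigma_1$ is free in the complex and each $\sigma_i$ is free in the complex obtained after collapsing at $\sigma_1,\dots,\sigma_{i-1}$; $\tau(\sigma_1),\tau(\sigma_2),\dots$ is the corresponding sequence of collapsed triangles. A 2-skeleton complex is weakly collapsible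 if some collapsing sequence of edges leaves no triangles. $P_\Sigma$ is the $m_1\times m_1$ permutation matrix that reorders the edges so that the $i$-th edge is $\sigma_i$, i.e. $[P_\Sigma]_{ij}=1\iff j=\sigma_i$ (edges not in $\Sigma$ placed last in any order), and $P_{\mathbb T}$ is the $m_2\times m_2$ permutation matrix acting on columns by right multiplication so that the $i$-th column of $B_2P_{\mathbb T}$ is the column of $B_2$ for $\tau(\sigma_i)$ (triangles not in $\mathbb T$ placed last in any order). $X^+$ is the Moore–Penrose pseudoinverse, and $\kappa_+(X)$ is the ratio of the largest to the smallest positive singular value of $X$. *)

(* Defs.v *)
From mathcomp Require Import boolp classical_sets reals.
From mathcomp Require Import all_boot all_order all_algebra all_fingroup.

Set Implicit Arguments.
Unset Strict Implicit.
Unset Printing Implicit Defensive.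
Import Order.TTheory GRing.Theory Num.Theory.
Local Open Scope ring_scope.

Section Complex.
Variable V : finType.
Implicit Types (K : {set {set V}}) (s : {set V}) (S : seq {set V}).

Definition simplicial_complex K : Prop :=
  set0 \notin K /\
  (forall s t : {set V}, s \in K -> t \subset s -> t != set0 -> t \in K).

Definition dim_le2 K : Prop := forall s, s \in K -> (#|s| <= 3)%N.

Definition vertices K : {set {set V}} := [set s in K | #|s| == 1%N]%SET.
Definition edges K : {set {set V}} := [set s in K | #|s| == 2%N]%SET.
Definition triangles K : {set {set V}} := [set s in K | #|s| == 3%N]%SET.

Definition cotriangles K s : {set {set V}} :=
  [set t in triangles K | s \subset t]%SET.

Definition free_edge K s : bool := (s \in edges K) && (#|cotriangles K s| == 1%N).

(* Only meaningful when [s] is free in [K]. *)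
Definition tau K s : {set V} := odflt set0 [pick t in cotriangles K s].

Definition collapse K s : {set {set V}} := K :\: [set s; tau K s]%SET.

Fixpoint collapsing_sequence K S : bool :=
  if S is s :: S' then free_edge K s && collapsing_sequence (collapse K s) S'
  else true.

Fixpoint collapsed_triangles K S : seq {set V} :=
  if S is s :: S' then tau K s :: collapsed_triangles (collapse K s) S'
  else [::].

Definition removes_all_triangles K S : bool :=
  triangles (foldl collapse K S) == set0.

Definition weakly_collapsible K : Prop :=
  exists S, collapsing_sequence K S /\ removes_all_triangles K S.

(* Ordered and oriented simplices: (a, b) stands for [a, b] and (a, b, c) for  *)
(* [a, b, c].                                                                  *)

Definition edge_set (e : V * V) : {set V} := [set e.1; e.2]%SET.
Definition triangle_set (t : V * V * V) : {set V} :=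
  [set t.1.1; t.1.2; t.2]%SET.

Definition enumerates (m : nat) (f : 'I_m -> {set V}) (A : {set {set V}}) :=
  injective f /\ (f @: [set: 'I_m]%SET)%SET = A.

(* The permutation [p] puts the simplices of [S] first, in the order of [S],   *)
(* and the remaining ones last, in any order.                                  *)
Definition reorders (m : nat) (f : 'I_m -> {set V}) S (p : 'S_m) : Prop :=
  forall i : 'I_m, (i < size S)%N -> f (p i) = nth set0 S i.

End Complex.

Section Boundary.
Variables (R : realType) (V : finType) (m1 m2 : nat).
Variables (e : 'I_m1 -> V * V) (t : 'I_m2 -> V * V * V).

(* Coordinate on [a, b] of the chain [c, d], with [d, c] = - [c, d]. *)
Definition edge_coord (ab cd : V * V) : R :=
  (ab == cd)%:R - (ab == (cd.2, cd.1))%:R.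

Definition boundary2 : 'M[R]_(m1, m2) :=
  \matrix_(i, j) let: (v1, v2, v3) := t j in
    edge_coord (e i) (v2, v3) - edge_coord (e i) (v1, v3)
      + edge_coord (e i) (v1, v2).

Variables w1 w2 : {set V} -> R.

Definition edge_weights : 'M[R]_m1 :=
  diag_mx (\row_i Num.sqrt (w1 (edge_set (e i)))).
Definition triangle_weights : 'M[R]_m2 :=
  diag_mx (\row_j Num.sqrt (w2 (triangle_set (t j)))).

Definition wboundary2 : 'M[R]_(m1, m2) :=
  invmx edge_weights *m boundary2 *m triangle_weights.

Definition up_laplacian1 : 'M[R]_m1 := wboundary2 *m wboundary2^T.

Definition subsampling (T : {set {set V}}) : 'M[R]_m2 :=
  diag_mx (\row_j (triangle_set (t j) \in T)%:R).

End Boundary.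

Section Reordering.
Variable R : realType.

(* Since perm_mx p i j = (p i == j)%:R, rows are put in the order p 0, p 1, ... *)
(* by perm_mx p on the left, and columns by its transpose on the right.         *)
Definition row_reorder (m : nat) (p : 'S_m) : 'M[R]_m := perm_mx p.
Definition col_reorder (m : nat) (q : 'S_m) : 'M[R]_m := (perm_mx q)^T.

Definition cholesky_multiplier (m1 m2 : nat) (B : 'M[R]_(m1, m2))
    (Pi : 'M[R]_m2) (p : 'S_m1) (q : 'S_m2) : 'M[R]_(m1, m2) :=
  row_reorder p *m B *m Pi *m col_reorder q.

End Reordering.

Section LinearAlgebra.
Variable R : realType.

(* Image and kernel for the action on column vectors (the operators of         *)
(* mxalgebra act on row vectors).                                              *)
Definition im_col (m n : nat) (A : 'M[R]_(m, n)) : set 'cV[R]_m :=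
  range (fun x : 'cV[R]_n => A *m x).
Definition ker_col (m n : nat) (A : 'M[R]_(m, n)) : set 'cV[R]_n :=
  [set x : 'cV[R]_n | A *m x = 0]%classic.

Definition moore_penrose (m n : nat) (X : 'M[R]_(m, n)) (Y : 'M[R]_(n, m)) :=
  [/\ X *m Y *m X = X, Y *m X *m Y = Y,
      (X *m Y)^T = X *m Y & (Y *m X)^T = Y *m X].

(* The default 0 is never used: see moore_penrose_ex and moore_penrose_uniq.   *)
Definition pseudoinverse (m n : nat) (X : 'M[R]_(m, n)) : 'M[R]_(n, m) :=
  xget 0 [set Y | moore_penrose X Y]%classic.

(* mathcomp's eigenvectors are row vectors; this is harmless since X^T X is    *)
(* symmetric.                                                                  *)
Definition pos_singular_value (m n : nat) (X : 'M[R]_(m, n)) (s : R) : Prop :=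
  0 < s /\ eigenvalue (X^T *m X) (s ^+ 2).

(* There are finitely many singular values, so this is largest over smallest   *)
(* when X != 0 (see kappa_plusE); it is 0 when X = 0, where the ratio is not   *)
(* defined.                                                                    *)
Definition kappa_plus (m n : nat) (X : 'M[R]_(m, n)) : R :=
  sup [set s | pos_singular_value X s]%classic /
  inf [set s | pos_singular_value X s]%classic.

Definition reduced_svd (m n r : nat) (B : 'M[R]_(m, n))
    (U : 'M[R]_(m, r)) (S : 'M[R]_r) (W : 'M[R]_(n, r)) : Prop :=
  [/\ is_diag_mx S, (forall i, 0 < S i i), U^T *m U = 1%:M, W^T *m W = 1%:M
    & B = U *m S *m W^T].

Lemma kappa_plusE (m n : nat) (X : 'M[R]_(m, n)) (smax smin : R) :
  pos_singular_value X smax -> pos_singular_value X smin ->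
  (forall s, pos_singular_value X s -> smin <= s <= smax) ->
  kappa_plus X = smax / smin.
Proof.
move=> Xmax Xmin Xb; rewrite /kappa_plus.
have ub : ubound [set s | pos_singular_value X s]%classic smax.
  by move=> s /Xb /andP[].
have lb : lbound [set s | pos_singular_value X s]%classic smin.
  by move=> s /Xb /andP[].
congr (_ / _); apply/le_anti/andP; split.
- by apply: ge_sup => //; exists smax.
- by apply: ub_le_sup => //; exists smax.
- by apply: ge_inf => //; exists smin.
- by apply: lb_le_inf => //; exists smin.
Qed.

Lemma gram_eq0 (m n : nat) (A : 'M[R]_(m, n)) : A *m A^T = 0 -> A = 0.
Proof.
move=> /matrixP A0; apply/matrixP => i j; rewrite mxE.
have := A0 i i; rewrite !mxE => /eqP; rewrite psumr_eq0; last first.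
  by move=> k _; rewrite mxE -expr2 sqr_ge0.
by move/allP/(_ j (mem_index_enum _)); rewrite mxE -expr2 sqrf_eq0 => /eqP.
Qed.

Lemma gram_unit (m n : nat) (A : 'M[R]_(m, n)) :
  row_free A -> A *m A^T \in unitmx.
Proof.
move=> fA; rewrite -row_free_unit -kermx_eq0; apply/eqP.
suff : kermx (A *m A^T) *m A = 0.
  by move/(congr1 (mulmx^~ (pinvmx A))); rewrite -mulmxA mulmxVp // mulmx1 mul0mx.
by apply: gram_eq0; rewrite trmx_mul mulmxA -(mulmxA _ A) mulmx_ker mul0mx.
Qed.

Lemma moore_penrose_ex (m n : nat) (X : 'M[R]_(m, n)) :
  exists Y, moore_penrose X Y.
Proof.
have [k [C [D [XE fC fD]]]] : exists k (C : 'M[R]_(m, k)) (D : 'M[R]_(k, n)),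
    [/\ X = C *m D, row_free C^T & row_free D].
  exists (\rank X), (col_base X), (row_base X).
  split; [by rewrite mulmx_base | | exact: row_base_free].
  by rewrite -row_leq_rank mxrank_tr col_leq_rank col_base_full.
have uD : D *m D^T \in unitmx by apply: gram_unit.
have uC : C^T *m C \in unitmx by have := gram_unit fC; rewrite trmxK.
pose G := invmx (C^T *m C); pose H := invmx (D *m D^T).
have GT : G^T = G by rewrite /G trmx_inv trmx_mul trmxK.
have HT : H^T = H by rewrite /H trmx_inv trmx_mul trmxK.
pose Y := D^T *m H *m (G *m C^T).
have XY : X *m Y = C *m G *m C^T.
  rewrite XE /Y -!mulmxA (mulmxA D) (mulmxA _ H) mulmxV // mul1mx.
  by rewrite !mulmxA.
have YX : Y *m X = D^T *m H *m D.
  by rewrite XE /Y -!mulmxA (mulmxA C^T) (mulmxA G) mulVmx // mul1mx.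
exists Y; split.
- by rewrite XY XE -!mulmxA (mulmxA C^T) (mulmxA G) mulVmx // mul1mx.
- rewrite YX /Y -!mulmxA (mulmxA D) (mulmxA H (D *m D^T)) mulVmx //.
  by rewrite mul1mx.
- by rewrite XY !trmx_mul trmxK GT mulmxA.
- by rewrite YX !trmx_mul trmxK HT mulmxA.
Qed.

Lemma moore_penrose_uniq (m n : nat) (X : 'M[R]_(m, n)) Y Z :
  moore_penrose X Y -> moore_penrose X Z -> Y = Z.
Proof.
case=> Y1 Y2 Y3 Y4 [Z1 Z2 Z3 Z4].
have XYZ : X *m Y = X *m Z.
  by rewrite -Y3 -{1}Z1 -mulmxA trmx_mul Y3 Z3 mulmxA Y1.
have YXZ : Y *m X = Z *m X.
  have E : Y *m X = Y *m X *m (Z *m X) by rewrite -mulmxA (mulmxA X) Z1.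
  by rewrite -Y4 E trmx_mul Y4 Z4 -mulmxA (mulmxA X) Y1.
by rewrite -Y2 -mulmxA XYZ mulmxA YXZ Z2.
Qed.

Lemma pseudoinverseP (m n : nat) (X : 'M[R]_(m, n)) :
  moore_penrose X (pseudoinverse X).
Proof. exact: (xgetPex 0 (moore_penrose_ex X)). Qed.

Lemma reduced_svd_im (m n r : nat) (B : 'M[R]_(m, n))
    (U : 'M[R]_(m, r)) (S : 'M[R]_r) (W : 'M[R]_(n, r)) :
  reduced_svd B U S W -> im_col W = im_col B^T.
Proof.
case=> /is_diag_mxP dS S0 UU WW BE.
have uS : S \in unitmx.
  rewrite unitmxE det_trig; last first.
    by apply/is_trig_mxP => i j ij; apply: dS; rewrite ltn_eqF.
  by rewrite unitfE; apply/prodf_neq0 => i _; rewrite gt_eqF.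
have BT : B^T = W *m (S^T *m U^T) by rewrite BE !trmx_mul trmxK.
apply/seteqP; split=> _ [x _ <-].
- exists (U *m (invmx S^T *m x)) => //.
  rewrite BT -!mulmxA (mulmxA U^T) UU mul1mx (mulmxA S^T) mulmxV ?unitmx_tr //.
  by rewrite mul1mx.
- by exists (S^T *m U^T *m x) => //; rewrite BT mulmxA.
Qed.

End LinearAlgebra.

(* Main.v *)
(* Permutations and matrices with orthonormal columns pass through the        *)
(* pseudoinverse, so with A = S1 V1^T Pi the preconditioned operator is       *)
(* N N^T, where N has the Gram matrix of A^+ S1; its singular values are thus *)
(* the squares of those of A^+ S1.  The kernel condition makes Y = Pi V1      *)
(* injective, whence A^+ S1 = Y (Y^T Y)^-1, whose Gram matrix is (Y^T Y)^-1:  *)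
(* its singular values are the inverses of those of Pi V1.                    *)
Require Import Defs.
From mathcomp Require Import boolp classical_sets reals.
From mathcomp Require Import all_boot all_order all_algebra all_fingroup.

Set Implicit Arguments.
Unset Strict Implicit.
Unset Printing Implicit Defensive.
Import Order.TTheory GRing.Theory Num.Theory.
Local Open Scope ring_scope.

(** Put [Y = Pi V1] and [A = S1 Y^T]. Then [C = (P U1) A Q^T] with [P], [Q] permutation matrices;
    the outer factors have orthonormal columns, so [pseudoinverse_isometry] gives
    [C^+ = Q A^+ (P U1)^T] and the preconditioned operator becomes [N N^T] with [N = Q A^+ S1].
    Passing to [N N^T] squares the condition number ([kappa_plus_gram]), and [Q] does not change it.
    For the second equality, the kernel condition makes [Y^T Y] invertible, so
    [A^+ S1 = Y (Y^T Y)^-1] ([pseudoinverse_mul_tr]), whose Gram matrix is the inverse of that of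
    [Y] ([kappa_plus_invgram]). *)

Lemma roots_sub_seq (F : fieldType) (p : {poly F}) :
  p != 0 -> exists rs : seq F, forall x, root p x -> x \in rs.
Proof.
have [n] := ubnP (size p); elim: n p => // n IHn p szp p0.
have [[x px]|noroot] := pselect (exists x, root p x); last first.
  by exists [::] => x px; case: noroot; exists x.
have /factor_theorem [g pE] := px.
have g0 : g != 0 by apply: contraNneq p0 => g0; rewrite pE g0 mul0r.
have [|rs rsP] := IHn g _ g0.
  by move: szp; rewrite pE size_Mmonic ?monicXsubC // size_XsubC addn2.
exists (x :: rs) => y; rewrite pE rootM root_XsubC inE.
by case/orP=> [/rsP ->|->]; rewrite ?orbT.
Qed.

Lemma seq_maximum (d : Order.disp_t) (T : orderType d) (s : seq T) (x : T) :
  x \in s -> exists2 y, y \in s & forall z, z \in s -> (z <= y)%O.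
Proof.
case: s => // a s _; elim: s a => [|b s IHs] a.
  by exists a; rewrite ?mem_head // => z; rewrite inE => /eqP ->.
have [y ys yP] := IHs b.
have [ya|ay] := leP y a.
  exists a; rewrite ?mem_head // => z; rewrite inE => /predU1P [->//|/yP zy].
  exact: le_trans ya.
exists y; first by rewrite inE ys orbT.
by move=> z; rewrite inE => /predU1P [->|/yP //]; apply: ltW.
Qed.

Section ConditionNumber.
Variable R : realType.

(** Singular values are roots of the characteristic polynomial of [X^T X] evaluated at the square of
    the variable, hence finite in number; so the [sup] and [inf] in [kappa_plus] are attained. *)
Lemma pos_singular_value_extrema (m n : nat) (X : 'M[R]_(m, n)) (s : R) :
  pos_singular_value X s ->
  exists smax smin, [/\ pos_singular_value X smax, pos_singular_value X smin
    & forall u, pos_singular_value X u -> smin <= u <= smax].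
Proof.
move=> Xs.
have p0 : char_poly (X^T *m X) \Po 'X^2 != 0.
  by rewrite comp_poly_eq0 ?size_polyXn // monic_neq0 ?char_poly_monic.
have [rs rsP] := roots_sub_seq p0.
pose sv := [seq u <- rs | `[< pos_singular_value X u >]].
have svP u : reflect (pos_singular_value X u) (u \in sv).
  apply: (iffP idP) => [|Xu]; first by rewrite mem_filter => /andP[/asboolP].
  rewrite mem_filter; apply/andP; split; first exact/asboolP.
  apply: rsP; case: Xu => _; rewrite eigenvalue_root_char.
  by rewrite /root horner_comp hornerXn.
have [smax /svP Xmax maxP] := seq_maximum (introT (svP s) Xs).
(* A maximum for the dual order is a minimum. *)
have [smin /svP Xmin minP] := @seq_maximum _ (R^d)%type sv s (introT (svP s) Xs).
exists smax, smin; split=> // u /svP su.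
by rewrite (maxP u su) andbT; apply: minP.
Qed.

(** The [sup] of the empty set is [0] by convention; this settles the degenerate case of the
    comparisons below. *)
Lemma kappa_plus_eq0 (m n : nat) (X : 'M[R]_(m, n)) :
  (forall s, ~ pos_singular_value X s) -> kappa_plus X = 0.
Proof.
move=> X0; rewrite /kappa_plus.
suff -> : [set s | pos_singular_value X s]%classic = classical_sets.set0.
  by rewrite sup0 mul0r.
by apply/seteqP; split=> s // /X0.
Qed.

(** Squaring is increasing on positive reals, so it carries extrema to extrema. *)
Lemma kappa_plus_sqr (m n m' n' : nat) (X : 'M[R]_(m, n)) (Y : 'M[R]_(m', n')) :
  (forall s, 0 < s -> pos_singular_value Y (s ^+ 2) <-> pos_singular_value X s) ->
  kappa_plus Y = kappa_plus X ^+ 2.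
Proof.
move=> XY.
have YP u : pos_singular_value Y u ->
    exists2 s, pos_singular_value X s & u = s ^+ 2.
  move=> Yu; have u0 : 0 < u by case: Yu.
  exists (Num.sqrt u); last by rewrite sqr_sqrtr // ltW.
  by apply/XY; rewrite ?sqrtr_gt0 // sqr_sqrtr // ltW.
have [[s Xs]|X0] := pselect (exists s, pos_singular_value X s); last first.
  rewrite !kappa_plus_eq0 ?expr0n // => u Xu; apply: X0; first by exists u.
  by have [s Xs _] := YP u Xu; exists s.
have [smax [smin [Xmax Xmin bd]]] := pos_singular_value_extrema Xs.
rewrite (kappa_plusE Xmax Xmin bd) expr_div_n.
have [max0 min0] : 0 < smax /\ 0 < smin by case: Xmax; case: Xmin.
apply: kappa_plusE; [exact/XY | exact/XY |].
move=> _ /YP [u Xu ->]; have /andP[lo hi] := bd u Xu; have u0 : 0 < u by case: Xu.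
by rewrite !ler_sqr ?lo ?hi ?nnegrE // ltW.
Qed.

(** Inversion reverses the order: the two extrema trade places and their ratio is unchanged. *)
Lemma kappa_plus_inv (m n m' n' : nat) (X : 'M[R]_(m, n)) (Y : 'M[R]_(m', n')) :
  (forall s, 0 < s -> pos_singular_value Y s^-1 <-> pos_singular_value X s) ->
  kappa_plus Y = kappa_plus X.
Proof.
move=> XY.
have YP u : pos_singular_value Y u -> pos_singular_value X u^-1.
  by move=> Yu; apply/XY; rewrite ?invrK // invr_gt0; case: Yu.
have [[s Xs]|X0] := pselect (exists s, pos_singular_value X s); last first.
  rewrite !kappa_plus_eq0 // => u Xu; apply: X0; first by exists u.
  by exists u^-1; apply: YP.
have [smax [smin [Xmax Xmin bd]]] := pos_singular_value_extrema Xs.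
rewrite (kappa_plusE Xmax Xmin bd).
have [max0 min0] : 0 < smax /\ 0 < smin by case: Xmax; case: Xmin.
have -> : smax / smin = smin^-1 / smax^-1 by rewrite invrK mulrC.
apply: kappa_plusE; [exact/XY | exact/XY |].
move=> u Yu; have u0 : 0 < u by case: Yu.
have /andP[lo hi] := bd _ (YP u Yu).
rewrite -[u]invrK !lef_pV2 ?posrE ?invr_gt0 //.
by rewrite lo hi.
Qed.

(** The map sending [v] to [v A] transports eigenvectors; [a != 0] keeps the image nonzero. *)
Lemma eigenvalue_mulmxC (m n : nat) (A : 'M[R]_(m, n)) (B : 'M[R]_(n, m)) (a : R) :
  a != 0 -> eigenvalue (A *m B) a -> eigenvalue (B *m A) a.
Proof.
move=> a0 /eigenvalueP[v vAB v0]; apply/eigenvalueP; exists (v *m A).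
  by rewrite mulmxA -(mulmxA v) vAB -scalemxAl.
apply: contraNneq v0 => vA0; move/esym/eqP: vAB.
by rewrite mulmxA vA0 mul0mx scaler_eq0 (negPf a0).
Qed.

Lemma eigenvalue_gram_sqr (m n : nat) (A : 'M[R]_(m, n)) (s : R) : 0 < s ->
  eigenvalue (A *m A^T *m (A *m A^T)) (s ^+ 2) = eigenvalue (A *m A^T) s.
Proof.
move=> s0; apply/eigenvalueP/eigenvalueP => [] [v vE v0]; last first.
  by exists v; rewrite // (mulmxA v) vE -scalemxAl vE scalerA expr2.
(* With [M = A A^T], the factorisation [M^2 - s^2 = (M + s)(M - s)] shows that [v (M + s)] is killed
   by [M - s]. *)
exists (v *m (A *m A^T) + s *: v).
  by rewrite mulmxDl -(mulmxA v) vE -scalemxAl scalerDr scalerA -expr2 addrC.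
(* A A^T is positive semidefinite, so - s is not an eigenvalue. *)
apply: contra v0 => /eqP w0.
have nrm_ge0 k (x : 'rV[R]_k) : 0 <= (x *m x^T) 0 0.
  by rewrite mxE; apply: sumr_ge0 => j _; rewrite mxE -expr2 sqr_ge0.
(* Pairing [v (M + s) = 0] with [v] gives a vanishing sum of two nonnegative terms. *)
have: (v *m A *m (v *m A)^T) 0 0 + s * (v *m v^T) 0 0 = 0.
  have := congr1 (fun w => (w *m v^T) 0 0) w0.
  by rewrite mulmxDl -scalemxAl mul0mx trmx_mul !mulmxA !mxE.
move/eqP; rewrite paddr_eq0 ?nrm_ge0 ?mulr_ge0 ?nrm_ge0 ?ltW //.
case/andP=> _; rewrite mulf_eq0 gt_eqF //= => /eqP vv0.
by apply/eqP/gram_eq0; rewrite [LHS]mx11_scalar vv0 raddf0.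
Qed.

Lemma kappa_plus_gram (m n : nat) (A : 'M[R]_(m, n)) :
  kappa_plus (A *m A^T) = kappa_plus A ^+ 2.
Proof.
apply: kappa_plus_sqr => s s0; have s20 : 0 < s ^+ 2 by rewrite exprn_gt0.
rewrite /pos_singular_value trmx_mul trmxK eigenvalue_gram_sqr //.
by split=> [] [_ /eigenvalue_mulmxC ev]; split=> //; apply: ev; rewrite gt_eqF.
Qed.

Lemma eigenvalue_invmx (n : nat) (A : 'M[R]_n) (a : R) :
  A \in unitmx -> a != 0 -> eigenvalue A a -> eigenvalue (invmx A) a^-1.
Proof.
move=> uA a0 /eigenvalueP[v vA v0]; apply/eigenvalueP; exists v => //.
by rewrite -{1}[v](scalerK a0) -vA -scalemxAl mulmxK.
Qed.

Lemma kappa_plus_invgram (m n m' : nat) (X : 'M[R]_(m, n)) (Y : 'M[R]_(m', n)) :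
  X^T *m X \in unitmx -> Y^T *m Y = invmx (X^T *m X) ->
  kappa_plus Y = kappa_plus X.
Proof.
move=> uX YX; apply: kappa_plus_inv => s s0.
have s20 : s ^+ 2 != 0 by rewrite expf_neq0 // gt_eqF.
rewrite /pos_singular_value YX exprVn; split=> [] [_ ev]; split; rewrite ?invr_gt0 //.
  rewrite -[X^T *m X]invmxK -[s ^+ 2]invrK.
  by apply: eigenvalue_invmx; rewrite ?unitmx_inv ?invr_eq0.
exact: eigenvalue_invmx.
Qed.

Lemma kappa_plus_isometry (m m' n : nat) (Q : 'M[R]_(m', m)) (X : 'M[R]_(m, n)) :
  Q^T *m Q = 1%:M -> kappa_plus (Q *m X) = kappa_plus X.
Proof.
move=> QQ; rewrite /kappa_plus /pos_singular_value.
by rewrite trmx_mul -mulmxA (mulmxA Q^T) QQ mul1mx.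
Qed.

Lemma pseudoinverse_eq (m n : nat) (X : 'M[R]_(m, n)) (Y : 'M[R]_(n, m)) :
  moore_penrose X Y -> pseudoinverse X = Y.
Proof. exact: moore_penrose_uniq (pseudoinverseP X). Qed.

Lemma pseudoinverse_isometry (m n m' n' : nat) (U : 'M[R]_(m', m))
    (X : 'M[R]_(m, n)) (W : 'M[R]_(n', n)) :
  U^T *m U = 1%:M -> W^T *m W = 1%:M ->
  pseudoinverse (U *m X *m W^T) = W *m pseudoinverse X *m U^T.
Proof.
move=> UU WW; have [XYX YXY XYT YXT] := pseudoinverseP X.
set Y := pseudoinverse X in XYX YXY XYT YXT *.
have XY : U *m X *m W^T *m (W *m Y *m U^T) = U *m (X *m Y) *m U^T.
  by rewrite -!mulmxA (mulmxA W^T) WW mul1mx.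
have YX : W *m Y *m U^T *m (U *m X *m W^T) = W *m (Y *m X) *m W^T.
  by rewrite -!mulmxA (mulmxA U^T) UU mul1mx.
apply: pseudoinverse_eq; split.
- by rewrite XY -[X in _ = U *m X *m _]XYX -!mulmxA (mulmxA U^T) UU mul1mx.
- by rewrite YX -[X in _ = W *m X *m _]YXY -!mulmxA (mulmxA W^T) WW mul1mx.
- by rewrite XY !trmx_mul trmxK -trmx_mul XYT mulmxA.
- by rewrite YX !trmx_mul trmxK -trmx_mul YXT mulmxA.
Qed.

(** Here [X = S Y^T] has full row rank, so its pseudoinverse is the right inverse [X^T (X X^T)^-1],
    in which [S^T] cancels. *)
Lemma pseudoinverse_mul_tr (k n : nat) (S : 'M[R]_k) (Y : 'M[R]_(n, k)) :
  S \in unitmx -> Y^T *m Y \in unitmx ->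
  pseudoinverse (S *m Y^T) = Y *m invmx (Y^T *m Y) *m invmx S.
Proof.
move=> uS uY; set G := invmx _.
have GT : G^T = G by rewrite trmx_inv trmx_mul trmxK.
have XY : S *m Y^T *m (Y *m G *m invmx S) = 1%:M.
  by rewrite -!mulmxA (mulmxA Y^T) (mulmxA _ G) mulmxV // mul1mx mulmxV.
have YX : Y *m G *m invmx S *m (S *m Y^T) = Y *m G *m Y^T.
  by rewrite -!mulmxA (mulmxA (invmx S)) mulVmx // mul1mx.
apply: pseudoinverse_eq; split.
- by rewrite XY mul1mx.
- by rewrite -[RHS]mulmx1 -XY !mulmxA.
- by rewrite XY trmx1.
- by rewrite YX !trmx_mul trmxK GT mulmxA.
Qed.

Lemma perm_mx_orthogonal (n : nat) (s : 'S_n) :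
  (perm_mx s)^T *m perm_mx s = 1%:M :> 'M[R]_n.
Proof. by rewrite tr_perm_mx -perm_mxM mulVg perm_mx1. Qed.

Lemma row_free_tr_inj (m n : nat) (A : 'M[R]_(m, n)) :
  (forall x : 'cV[R]_n, A *m x = 0 -> x = 0) -> row_free A^T.
Proof.
move=> injA; apply: inj_row_free => v /(congr1 trmx).
by rewrite trmx_mul trmxK trmx0 => /injA /(congr1 trmx); rewrite trmxK trmx0.
Qed.

Lemma reduced_svd_unit (m n r : nat) (B : 'M[R]_(m, n))
    (U : 'M[R]_(m, r)) (S : 'M[R]_r) (W : 'M[R]_(n, r)) :
  reduced_svd B U S W -> S \in unitmx.
Proof.
case=> /is_diag_mx_is_trig dS S0 _ _ _.
by rewrite unitmxE det_trig // unitfE; apply/prodf_neq0 => i _; rewrite gt_eqF.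
Qed.

End ConditionNumber.

Theorem theorem6p6 (R : realType) (V : finType) (K : {set {set V}})
    (hK : simplicial_complex K) (hK2 : dim_le2 K)
    (m1 m2 : nat) (e : 'I_m1 -> V * V) (t : 'I_m2 -> V * V * V)
    (he : enumerates (fun i => edge_set (e i)) (edges K))
    (ht : enumerates (fun j => triangle_set (t j)) (triangles K))
    (w1 w2 : {set V} -> R)
    (hw1 : forall s, s \in edges K -> 0 <= w1 s)
    (hw2 : forall s, s \in triangles K -> 0 <= w2 s)
    (hW1 : edge_weights e w1 \in unitmx)
    (T : {set {set V}}) (hT : T \subset triangles K)
    (L : {set {set V}}) (hL : L = vertices K :|: edges K :|: T)
    (hLc : weakly_collapsible L)
    (B2 : 'M[R]_(m1, m2)) (hB2 : B2 = wboundary2 e t w1 w2)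
    (Pi : 'M[R]_m2) (hPi : Pi = subsampling R t T)
    (hker : (im_col B2^T `&` ker_col Pi = [set 0])%classic)
    (Sigma : seq {set V})
    (hSigma : collapsing_sequence L Sigma)
    (hSigmaT : removes_all_triangles L Sigma)
    (p : 'S_m1) (hp : reorders (fun i => edge_set (e i)) Sigma p)
    (q : 'S_m2)
    (hq : reorders (fun j => triangle_set (t j)) (collapsed_triangles L Sigma) q)
    (C : 'M[R]_(m1, m2)) (hC : C = cholesky_multiplier B2 Pi p q)
    (r : nat) (U1 : 'M[R]_(m1, r)) (S1 : 'M[R]_r) (V1 : 'M[R]_(m2, r))
    (hsvd : reduced_svd B2 U1 S1 V1) :
  kappa_plus (pseudoinverse C *m (row_reorder R p *m up_laplacian1 e t w1 w2
                *m (row_reorder R p)^T) *m (pseudoinverse C)^T)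
    = kappa_plus (pseudoinverse (S1 *m V1^T *m Pi) *m S1) ^+ 2
  /\ kappa_plus (pseudoinverse (S1 *m V1^T *m Pi) *m S1) ^+ 2
    = kappa_plus (Pi *m V1) ^+ 2.
Proof.
have uS := reduced_svd_unit hsvd.
have imV := reduced_svd_im hsvd.
case: (hsvd) => _ _ UU VV BE.
have PiT : Pi^T = Pi by rewrite hPi tr_diag_mx.
set Y := Pi *m V1.
have AE : S1 *m V1^T *m Pi = S1 *m Y^T by rewrite trmx_mul PiT mulmxA.
have uY : Y^T *m Y \in unitmx.
  (* If [Y x = 0], then [V1 x] lies in both [im B2^T] and [ker Pi], so it vanishes, and
     [x = V1^T V1 x = 0]. *)
  rewrite -{2}[Y]trmxK; apply/gram_unit/row_free_tr_inj => x Yx0.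
  have : (im_col B2^T `&` ker_col Pi)%classic (V1 *m x).
    by split; [rewrite -imV; exists x | rewrite /ker_col /= mulmxA].
  by rewrite hker => Vx0; rewrite -[x]mul1mx -VV -mulmxA Vx0 mulmx0.
have ApS : pseudoinverse (S1 *m Y^T) *m S1 = Y *m invmx (Y^T *m Y).
  by rewrite pseudoinverse_mul_tr // mulmxKV.
clearbody Y; rewrite AE; split; last first.
  congr (_ ^+ 2); rewrite ApS; apply: kappa_plus_invgram => //.
  rewrite trmx_mul -mulmxA (mulmxA Y^T Y) mulmxV // mulmx1.
  by rewrite trmx_inv trmx_mul trmxK.
set P := row_reorder R p; set Q : 'M[R]_m2 := perm_mx q.
have QQ : Q^T *m Q = 1%:M by apply: perm_mx_orthogonal.
have PU : (P *m U1)^T *m (P *m U1) = 1%:M.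
  by rewrite trmx_mul -mulmxA (mulmxA P^T) perm_mx_orthogonal mul1mx.
have CE : C = P *m U1 *m (S1 *m Y^T) *m Q^T.
  by rewrite hC /cholesky_multiplier BE -AE !mulmxA.
(* The factor [(P U1)^T] of the pseudoinverse meets the [P U1] of [P B2] and cancels. *)
have CpB : pseudoinverse C *m (P *m B2)
    = Q *m (pseudoinverse (S1 *m Y^T) *m S1) *m V1^T.
  rewrite CE pseudoinverse_isometry // {1}BE !mulmxA.
  by rewrite -(mulmxA _ P U1) -(mulmxA _ _ (P *m U1)) PU mulmx1.
(* The operator is the product of [C^+ P B2] with its transpose, and [V1^T V1 = 1] removes [V1] from
   the middle. *)
have -> : pseudoinverse C *m (P *m up_laplacian1 e t w1 w2 *m P^T)
      *m (pseudoinverse C)^T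
    = Q *m (pseudoinverse (S1 *m Y^T) *m S1)
      *m (Q *m (pseudoinverse (S1 *m Y^T) *m S1))^T.
  transitivity ((pseudoinverse C *m (P *m B2)) *m (pseudoinverse C *m (P *m B2))^T).
    by rewrite /up_laplacian1 -hB2 !trmx_mul !mulmxA.
  by rewrite CpB [X in _ *m X]trmx_mul trmxK -mulmxA (mulmxA V1^T) VV mul1mx.
by rewrite kappa_plus_gram kappa_plus_isometry.
Qed.
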